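(* Let $(X,E,B,\tilde B)$ be an admissible quadruple. Suppose $\tilde B$ is a strong Ditkin algebra. Then $E$ and $B$ are strong Ditkin algebras.
   Context: Banach algebras are over $\mathbb{C}$. For a commutative Banach algebra $A$ with unit, $M(A)$ is the set of nonzero multiplicative linear functionals $A\to\mathbb{C}$ with the relative weak-star topology from $A^*$, and $\hat a(\phi)=\phi(a)$. The support $\mathrm{supp}(a)$ of $a\in A$ is the closure in $M(A)$ of $\{\phi\in M(A):\hat a(\phi)\ne0\}$. For $\phi\in M(A)$ put $I_\phi=\{a\in A:\hat a(\phi)=0\}$ and $J_\phi=\{a\in A:\phi\notin\mathrm{supp}(a)\}$. $A$ is a strong Ditkin algebra if for each $\phi\in M(A)$ the ideal $I_\phi$ has a bounded approximate identity contained in $J_\phi$, i.e. there exist $m_\phi>0$ and a sequence of elements $u_n\in J_\phi$ ($n\in\mathbb{N}$) such that $\|u_n\|\le m_\phi$ for each $n$ and $\|a-au_n\|\to0$ as $n\to\infty$ for each $a\in I_\phi$. $C(X,E)$ is the algebra of all continuous maps $X\to E$ with pointwise operations, and $C(X)=C(X,\mathbb{C})$. An $E$-valued function algebra on $X$ is a subalgebra $A\subset C(X,E)$, equipped with some norm that makes it complete, such that (1) $A$ contains the constant function $x\mapsto 1_E$; (2) $A$ separates the points of $X$; (3) for each $x\in X$ the evaluation map $e_x:A\to E$, $f\mapsto f(x)$, is continuous. A $\mathbb{C}$-valued function algebra $B$ on $X$ is natural if every element of $M(B)$ is evaluation at a point of $X$. An admissible quadruple is a quadruple $(X,E,B,\tilde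 B)$ where: $X$ is a compact Hausdorff space; $E$ is a commutative Banach algebra with unit; $B\subset C(X)$ is a natural $\mathbb{C}$-valued function algebra on $X$; $\tilde B\subset C(X,E)$ is an $E$-valued function algebra on $X$; $B\cdot E\subset\tilde B$ (that is, $x\mapsto g(x)a$ belongs to $\tilde B$ for all $g\in B$, $a\in E$); and $\{\lambda\circ f: f\in\tilde B,\ \lambda\in M(E)\}\subset B$. *)

(* Defs.v *)
From HB Require Import structures.
From mathcomp Require Import all_boot all_order all_algebra complex.
From mathcomp Require Import all_classical all_reals topology normedtype.
From mathcomp Require Import sequences.

Set Implicit Arguments.
Unset Strict Implicit.
Unset Printing Implicit Defensive.

Import Order.TTheory GRing.Theory Num.Theory.
Import numFieldNormedType.Exports.

Local Open Scope classical_set_scope.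
Local Open Scope ring_scope.

(* The norm of a module over R[i] takes its values in R[i]; they are nonnegative
   for the partial order of R[i], hence real. *)

HB.instance Definition _ (R : realType) := NormedModule.copy R[i] R[i]^o.

(* HB has no structure joining rings and normed modules, so the product is given
   here as data on a complete normed module, and the ring structure is declared
   on the type [calg_car A] below. The norm is not assumed submultiplicative. *)
Record completeNormedComAlg (R : realType) := CompleteNormedComAlg {
  calg_mod : completeNormedModType R[i];
  calg_one : calg_mod;
  calg_mul : calg_mod -> calg_mod -> calg_mod;
  calg_mulA : associative calg_mul;
  calg_mulC : commutative calg_mul;
  calg_mul1 : left_id calg_one calg_mul;
  calg_mulDl : left_distributive calg_mul +%R;
  calg_one_neq0 : calg_one != 0;
  calg_scaleAl : forall (k : R[i]) (a b : calg_mod),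
    k *: calg_mul a b = calg_mul (k *: a) b
}.

Definition calg_car (R : realType) (A : completeNormedComAlg R) : Type :=
  calg_mod A.

Coercion calg_car : completeNormedComAlg >-> Sortclass.

Section calg_instances.
Variables (R : realType) (A : completeNormedComAlg R).

HB.instance Definition _ := CompleteNormedModule.copy (calg_car A) (calg_mod A).

HB.instance Definition _ := GRing.Zmodule_isComNzRing.Build (calg_car A)
  (@calg_mulA R A) (@calg_mulC R A) (@calg_mul1 R A) (@calg_mulDl R A)
  (@calg_one_neq0 R A).

HB.instance Definition _ := GRing.Lmodule_isLalgebra.Build R[i] (calg_car A)
  (@calg_scaleAl R A).

HB.instance Definition _ := GRing.Lalgebra_isComAlgebra.Build R[i] (calg_car A).

End calg_instances.

Record comBanachAlg (R : realType) := ComBanachAlg {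
  balg_alg :> completeNormedComAlg R;
  balg_normM : forall a b : balg_alg, `|a * b| <= `|a| * `|b|
}.

Section complex_banach.
Variable R : realType.

Lemma complex_complete (F : set_system R[i]) :
  ProperFilter F -> cauchy F -> cvg F.
Proof.
move=> FF Fc.
have re_im (z : R[i]) : (`|complex.Re z|%:C%C <= `|z|) /\
    (`|complex.Im z|%:C%C <= `|z|).
  split; first exact: normc_ge_Re.
  rewrite normc_def lecR -sqrtr_sqr ler_wsqrtr // lerDr; exact: sqr_ge0.
have cvg_part (p : R[i] -> R) : {morph p : x y / x - y} ->
    (forall z, `|p z|%:C%C <= `|z|) -> cvg (p @ F).
  move=> pB ple; apply: cauchy_cvg; apply/cauchy_ballP => e e0.
  have eC0 : 0 < e%:C%C by rewrite ltcR.
  have /cauchy_ballP/(_ _ eC0) := Fc.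
  case=> -[P Q] /= [FP FQ] PQ.
  exists (p @` P, p @` Q) => /=.
    by split; [apply: filterS FP|apply: filterS FQ] => z Pz /=; exists z.
  move=> [_ _] /= [[x Px <-] [y Qy <-]].
  have /= := PQ (x, y) (conj Px Qy).
  rewrite -!ball_normE /= => xy.
  by rewrite -ltcR -pB (le_lt_trans _ xy).
have /cvg_ex[/= a Fa] : cvg (@complex.Re R @ F).
  by apply: cvg_part => [[? ?] [? ?]//|z]; case: (re_im z).
have /cvg_ex[/= b Fb] : cvg (@complex.Im R @ F).
  by apply: cvg_part => [[? ?] [? ?]//|z]; case: (re_im z).
apply/cvg_ex; exists (a +i* b)%C; apply/cvgrPdist_lt => e e0.
have [e1 e1E] : exists e1 : R, e = e1%:C%C.
  by exists (complex.Re e); rewrite RRe_real // gtr0_real.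
rewrite {}e1E in e0 *; rewrite ltcR in e0.
have e20 : 0 < e1 / 2 by rewrite divr_gt0.
move/cvgrPdist_lt : Fa => /(_ _ e20) Fa.
move/cvgrPdist_lt : Fb => /(_ _ e20) Fb.
have dist_le (z : R[i]) : `|(a +i* b)%C - z| <=
    (`|a - complex.Re z| + `|b - complex.Im z|)%:C%C.
  have -> : (a +i* b)%C - z =
      (a - complex.Re z)%:C%C + 'i%C * (b - complex.Im z)%:C%C.
    by case: z => x y; simpc.
  rewrite (le_trans (ler_normD _ _)) // normrM !normc_def /=.
  by rewrite !expr0n /= expr1n !addr0 add0r sqrtr1 mul1r !sqrtr_sqr -rmorphD.
near=> z.
rewrite (le_lt_trans (dist_le z)) // ltcR (splitr e1) ltrD //.
  by near: z.
by near: z.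
Unshelve. all: by end_near. Qed.

HB.instance Definition _ := Uniform_isComplete.Build R[i] complex_complete.

Definition complex_calg : completeNormedComAlg R :=
  @CompleteNormedComAlg R R[i] 1 *%R (@mulrA _) (@mulrC _) (@mul1r _)
    (@mulrDl _) (oner_neq0 _) (fun k a b => mulrA k a b).

Lemma complex_normM (a b : complex_calg) : `|a * b| <= `|a| * `|b|.
Proof. by rewrite (@normrM R[i]). Qed.

Definition complex_balg : comBanachAlg R := ComBanachAlg complex_normM.

End complex_banach.

Record character (R : realType) (A : completeNormedComAlg R) := Character {
  char_fun :> A -> R[i];
  char_scalar : scalar char_fun;
  char_mul : {morph char_fun : a b / a * b};
  char_neq0 : exists a, char_fun a != 0
}.

(* The weak-star topology of the dual is the topology of pointwise convergence,
   so the relative one is induced by the inclusion of the characters in the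
   product space of all functions A -> R[i]. *)
Definition char_ptws (R : realType) (A : completeNormedComAlg R)
  (phi : character A) : {ptws A -> R[i]} := phi.

HB.instance Definition _ (R : realType) (A : completeNormedComAlg R) :=
  gen_eqMixin (character A).
HB.instance Definition _ (R : realType) (A : completeNormedComAlg R) :=
  gen_choiceMixin (character A).
HB.instance Definition _ (R : realType) (A : completeNormedComAlg R) :=
  Topological.copy (character A) (initial_topology (@char_ptws R A)).

Section strong_ditkin.
Variables (R : realType) (A : completeNormedComAlg R).

Definition gelfand (a : A) (phi : character A) : R[i] := phi a.

Definition supp (a : A) : set (character A) :=
  closure [set phi : character A | gelfand a phi != 0].

Definition I_ (phi : character A) : set A := [set a | gelfand a phi = 0].

Definition J_ (phi : character A) : set A := [set a | ~ supp a phi].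

Definition strong_ditkin : Prop :=
  forall phi : character A, exists (m : R) (u : nat -> A),
    [/\ 0 < m,
        forall n, J_ phi (u n),
        forall n, `|u n| <= m%:C%C &
        forall a, I_ phi a -> `|a - a * u n| @[n --> \oo] --> (0 : R[i])].

End strong_ditkin.

(* A subalgebra of C(X, E) with a complete norm is given as an algebra [falg]
   with an injective unital algebra morphism [feval] into the continuous
   functions: [f : falg] is identified with the function [feval f]. *)
Record functionAlgebra (R : realType) (X : topologicalType)
    (E : comBanachAlg R) := FunctionAlgebra {
  falg :> completeNormedComAlg R;
  feval : falg -> X -> E;
  feval_inj : injective feval;
  feval_continuous : forall f, continuous (feval f);
  feval1 : forall x, feval 1 x = 1;
  feval_linear : forall (k : R[i]) f g x,
    feval (k *: f + g) x = k *: feval f x + feval g x;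
  fevalM : forall f g x, feval (f * g) x = feval f x * feval g x;
  feval_separates : forall x y, x <> y -> exists f, feval f x <> feval f y;
  feval_at_continuous : forall x, continuous (feval^~ x)
}.

Definition natural (R : realType) (X : topologicalType)
    (B : functionAlgebra X (complex_balg R)) : Prop :=
  forall phi : character B, exists x : X, forall g : B, phi g = feval g x.

Record admissible (R : realType) (X : topologicalType) (E : comBanachAlg R)
    (B : functionAlgebra X (complex_balg R)) (Bt : functionAlgebra X E) : Prop :=
  Admissible {
  adm_compact : compact [set: X];
  adm_hausdorff : hausdorff_space X;
  adm_natural : natural B;
  adm_tensor : forall (g : B) (a : E), exists f : Bt,
    feval f = fun x => (feval g x : R[i]) *: a;
  adm_comp : forall (f : Bt) (lambda : character E), exists g : B,
    feval g = lambda \o feval f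
}.

(* Main.v *)
(* The strong Ditkin property passes to the image of a surjective algebra
   homomorphism T with closed graph: T is bounded by the closed graph theorem,
   phi |-> phi o T is weak-star continuous on characters, and T maps a bounded
   approximate identity of the ideal of phi o T to one of the ideal of phi.
   Evaluation at a point is such a map onto E, and f |-> chi o f is such a map
   onto B, for any continuous character chi of E; no description of the
   characters of the algebra of E-valued functions is needed.

   A character of E is obtained from a minimal unital submultiplicative seminorm p
   below the norm. Minimality makes p power multiplicative (compare with the
   spectral radius) and then multiplicative (compare with
   b |-> inf_n p (a^n b) / p(a)^n). For a multiplicative p, Ostrowski's argument
   shows that every a has p (a - z) = 0 for some scalar z: if the minimum m of
   p (a - z) is positive, with b = a - z0 attaining it, then factoring b^N - c^N
   for N = 2^k gives p (b - c) <= m (1 + (|c| / m)^N), so the minimum is attained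
   on a whole disc of radius m, hence everywhere. *)

Require Import Defs.
From mathcomp Require Import all_boot all_order all_algebra complex ring lra.
From mathcomp Require Import all_classical all_reals topology normedtype.
From mathcomp Require Import sequences derive.

Set Implicit Arguments.
Unset Strict Implicit.
Unset Printing Implicit Defensive.

Import Order.TTheory GRing.Theory Num.Theory.
Import numFieldNormedType.Exports.
Import Normc.

Local Open Scope classical_set_scope.
Local Open Scope ring_scope.

(** * Elementary estimates on moduli, infima and powers *)

Lemma normcX (R : rcfType) (z : R[i]) n : normc (z ^+ n) = normc z ^+ n.
Proof.
elim: n => [|n IH]; first by rewrite !expr0 normc1.
by rewrite !exprS normcM IH.
Qed.

Lemma normc_ge0 (R : rcfType) (z : R[i]) : 0 <= normc z.
Proof. by case: z => x y; exact: sqrtr_ge0. Qed.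

Lemma le_inf_mulr (R : realType) (S : set R) (x t : R) :
  S !=set0 -> 0 <= t -> (forall s, S s -> x <= s * t) -> x <= inf S * t.
Proof.
move=> S0; rewrite le_eqVlt => /predU1P[<- |t0] Sx.
  by case: S0 => s /Sx; rewrite !mulr0.
rewrite -ler_pdivrMr//; apply: lb_le_inf => // s Ss.
by rewrite ler_pdivrMr// Sx.
Qed.

Lemma expr_bound (R : realType) (K t : R) :
  0 <= t -> (forall n, 1 <= K * t ^+ n) -> 1 <= t.
Proof.
move=> t0 Kt; rewrite leNgt; apply/negP => t1.
have K0 : 0 < K by have := Kt 0%N; rewrite expr0 mulr1; lra.
have : t ^+ n @[n --> \oo] --> (0 : R) by apply: cvg_expr; rewrite ger0_norm.
move/cvgrPdist_lt => /(_ K^-1); rewrite invr_gt0 => /(_ K0)[n _ /(_ n (leqnn _))].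
rewrite /= sub0r normrN ger0_norm ?exprn_ge0// => tn.
have := Kt n; rewrite leNgt => /negP; apply.
by rewrite -(mulfV (lt0r_neq0 K0)) ltr_pM2l.
Qed.

Lemma bernoulli (R : realDomainType) n (x : R) :
  x <= 1 -> 1 - n%:R * x <= (1 - x) ^+ n.
Proof.
move=> x1; elim: n => [|n IH]; first by rewrite expr0 mul0r subr0.
rewrite exprS; apply: (@le_trans _ _ ((1 - x) * (1 - n%:R * x))).
  by rewrite -natr1; have := mulr_ge0 (ler0n R n) (sqr_ge0 x); lra.
by rewrite ler_wpM2l// subr_ge0.
Qed.

(** * Minimal submultiplicative seminorms *)

Section submultiplicative_seminorms.
Variables (R : realType) (A : comAlgType R[i]).

(** All clauses are inequalities that survive infima of suitable families; [1 <= p 1] keeps such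
    infima away from the zero seminorm. *)
Record submult_seminorm (p : A -> R) : Prop := SubmultSeminorm {
  seminorm_ge0 : forall a, 0 <= p a;
  seminormD : forall a b, p (a + b) <= p a + p b;
  seminormZ : forall z a, p (z *: a) <= normc z * p a;
  seminormM : forall a b, p (a * b) <= p a * p b;
  seminorm1 : 1 <= p 1
}.

(* Each value [S a] is thought of as a set of upper bounds for a seminorm at [a]. *)
Record seminorm_bounds (S : A -> set R) : Prop := SeminormBounds {
  bounds_nonempty : forall a, S a !=set0;
  bounds_ge0 : forall a s, S a s -> 0 <= s;
  boundsD : forall a b s t, S a s -> S b t -> S (a + b) (s + t);
  boundsZ : forall z a s, S a s -> S (z *: a) (normc z * s);
  boundsM : forall a b s t, S a s -> S b t -> S (a * b) (s * t);
  bounds1 : forall s, S 1 s -> 1 <= s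
}.

Lemma inf_bounds_le (S : A -> set R) a s :
  seminorm_bounds S -> S a s -> inf (S a) <= s.
Proof.
by move=> Sb Sas; apply: ge_inf => //; exists 0 => t; exact: (bounds_ge0 Sb).
Qed.

(** Each clause for the infimum follows by varying one upper bound at a time. This single
    construction serves chains in Zorn's lemma, the spectral radius and the orbit seminorm. *)
Lemma inf_seminorm (S : A -> set R) :
  seminorm_bounds S -> submult_seminorm (fun a => inf (S a)).
Proof.
move=> Sb; have Sne := bounds_nonempty Sb.
have inf0 a : 0 <= inf (S a).
  by apply: lb_le_inf => // s; exact: (bounds_ge0 Sb).
split=> //.
- move=> a b; rewrite -lerBlDr; apply: lb_le_inf => // s Ss.
  rewrite lerBlDr -lerBlDl; apply: lb_le_inf => // t St.
  by rewrite lerBlDl; apply: inf_bounds_le => //; exact: boundsD.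
- move=> z a; rewrite mulrC; apply: le_inf_mulr => //; first exact: normc_ge0.
  by move=> s Ss; rewrite mulrC; apply: inf_bounds_le => //; exact: boundsZ.
- move=> a b; apply: le_inf_mulr => // s Ss; rewrite [s * _]mulrC.
  apply: (@le_inf_mulr _ (S b)) => //; first exact: (bounds_ge0 Sb Ss).
  by move=> t St; rewrite [t * _]mulrC; apply: inf_bounds_le => //; exact: boundsM.
- by apply: lb_le_inf => // s; exact: (bounds1 Sb).
Qed.

Section theory.
Variable p : A -> R.
Hypothesis pP : submult_seminorm p.
Let p0 := seminorm_ge0 pP.

Lemma seminorm0 : p 0 = 0.
Proof.
apply/eqP; rewrite eq_le p0 andbT.
by have := seminormZ pP 0 0; rewrite scale0r normc0 mul0r.
Qed.

Lemma seminormN a : p (- a) = p a.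
Proof.
suff H b : p (- b) <= p b by apply/eqP; rewrite eq_le H -{1}(opprK a) H.
by have := seminormZ pP (-1) b; rewrite scaleN1r normcN normc1 mul1r.
Qed.

Lemma seminormMn a n : p (a *+ n) <= p a *+ n.
Proof.
elim: n => [|n IH]; first by rewrite !mulr0n seminorm0.
by rewrite !mulrS (le_trans (seminormD pP _ _))// lerD2l.
Qed.

Lemma seminorm_sum I (r : seq I) (F : I -> A) :
  p (\sum_(i <- r) F i) <= \sum_(i <- r) p (F i).
Proof.
elim/big_ind2 : _ => //; first by rewrite seminorm0.
by move=> a s b t H1 H2; rewrite (le_trans (seminormD pP _ _))// lerD.
Qed.

Lemma seminormXM a b n : p (a ^+ n * b) <= p a ^+ n * p b.
Proof.
elim: n => [|n IH]; first by rewrite !expr0 !mul1r.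
rewrite !exprS -!mulrA (le_trans (seminormM pP _ _))//.
by rewrite ler_wpM2l.
Qed.

Lemma seminormX a n : p (a ^+ n) <= p a ^+ n * p 1.
Proof. by rewrite -{1}(mulr1 (a ^+ n)) seminormXM. Qed.

Lemma seminorm_alg_ge z : normc z <= p (z%:A).
Proof.
have [->|z0] := eqVneq z 0; first by rewrite normc0.
have nz0 : 0 < normc z.
  by rewrite lt_neqAle normc_ge0 andbT eq_sym; apply: contra z0 => /eqP/eq0_normc ->.
have := seminormZ pP z^-1 z%:A; rewrite scalerA mulVf// scale1r normcV.
move=> /(le_trans (seminorm1 pP)).
by rewrite mulrC -ler_pdivrMr ?invr_gt0// invrK mul1r.
Qed.

(* The infimum of these bounds is the spectral radius. *)
Definition power_bounds (a : A) : set R :=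
  [set t | 0 <= t /\ exists K, forall n, p (a ^+ n) <= K * t ^+ n].

Lemma power_boundsP : seminorm_bounds power_bounds.
Proof.
split.
- move=> a; exists (p a); split=> //; exists (p 1) => n.
  by rewrite mulrC seminormX.
- by move=> a s [].
(* By commutativity the binomial formula applies, and bounding it termwise gives
   [K * L * (s + t) ^+ n]. *)
- move=> a b s t [s0 [K Ks]] [t0 [L Lt]]; split; first exact: addr_ge0.
  exists (K * L) => n; rewrite !exprDn (le_trans (seminorm_sum _ _))//.
  rewrite mulr_sumr; apply: ler_sum => i _.
  rewrite (le_trans (seminormMn _ _))// mulrnAr lerMn2r; apply/orP; right.
  rewrite (le_trans (seminormM pP _ _))//.
  by rewrite mulrACA ler_pM ?(seminorm_ge0 pP).
- move=> z a s [s0 [K Ks]]; split; first by rewrite mulr_ge0 ?normc_ge0.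
  exists K => n; rewrite exprZn (le_trans (seminormZ pP _ _))// normcX exprMn.
  by rewrite mulrCA ler_wpM2l// exprn_ge0// normc_ge0.
- move=> a b s t [s0 [K Ks]] [t0 [L Lt]]; split; first exact: mulr_ge0.
  exists (K * L) => n; rewrite !exprMn (le_trans (seminormM pP _ _))//.
  by rewrite mulrACA ler_pM ?(seminorm_ge0 pP).
- move=> s [s0 [K Ks]]; apply: (@expr_bound _ K) => // n.
  by have := Ks n; rewrite expr1n; exact/le_trans/seminorm1.
Qed.

(** For [0 < p a] the infimum of these bounds is the infimum over n of
    [p (a ^+ n * b) / p a ^+ n]. *)
Definition orbit_bounds (a b : A) : set R :=
  [set t | 0 <= t /\ exists n, p (a ^+ n * b) <= t * p a ^+ n].

(** A bound valid at n stays valid at every larger exponent, because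
    [p (a ^+ m * c) <= p a ^+ m * p c]; so two bounds can both be used at [n + m]. Power
    multiplicativity of p at a is what gives the bound at 1. *)
Lemma orbit_boundsP a : 0 < p a -> (forall n, p a ^+ n <= p (a ^+ n)) ->
  seminorm_bounds (orbit_bounds a).
Proof.
move=> pa0 paX; split.
- by move=> b; exists (p b); split=> //; exists 0%N; rewrite !expr0 mul1r mulr1.
- by move=> b s [].
- move=> b c s t [s0 [n ns]] [t0 [m mt]]; split; first exact: addr_ge0.
  exists (n + m)%N; rewrite mulrDr (le_trans (seminormD pP _ _))// mulrDl lerD//.
    rewrite addnC exprD -mulrA (le_trans (seminormXM _ _ _))//.
    by rewrite exprD mulrCA ler_wpM2l// exprn_ge0.
  rewrite exprD -mulrA (le_trans (seminormXM _ _ _))//.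
  by rewrite exprD mulrCA ler_wpM2l// exprn_ge0.
- move=> z b s [s0 [n ns]]; split; first by rewrite mulr_ge0 ?normc_ge0.
  exists n; rewrite -scalerAr (le_trans (seminormZ pP _ _))// -mulrA.
  by rewrite ler_wpM2l// normc_ge0.
- move=> b c s t [s0 [n ns]] [t0 [m mt]]; split; first exact: mulr_ge0.
  exists (n + m)%N; rewrite !exprD mulrACA (le_trans (seminormM pP _ _))//.
  by rewrite mulrACA ler_pM ?(seminorm_ge0 pP).
- move=> s [s0 [n ns]]; rewrite mulr1 in ns.
  by have := le_trans (paX n) ns; rewrite ler_pMl// exprn_gt0.
Qed.

End theory.

Definition minimal_seminorm (p : A -> R) : Prop :=
  submult_seminorm p /\
  forall q, submult_seminorm q -> (forall a, q a <= p a) -> forall a, p a <= q a.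

Lemma minimal_seminorm_le_bounds p S : minimal_seminorm p -> seminorm_bounds S ->
  (forall a, S a (p a)) -> forall a s, S a s -> p a <= s.
Proof.
move=> [pP pmin] Sb Sp a s Sas.
apply: (le_trans (pmin _ (inf_seminorm Sb) _ a)) => [b|].
  exact: inf_bounds_le (Sp b).
exact: inf_bounds_le.
Qed.

Lemma minimal_seminorm_exists p0 : submult_seminorm p0 ->
  exists2 p, minimal_seminorm p & forall a, p a <= p0 a.
Proof.
move=> p0P; pose T := {p : A -> R | submult_seminorm p /\ forall a, p a <= p0 a}.
pose t0 : T := exist _ p0 (conj p0P (fun a => lexx _)).
(* The order is reversed, so that a maximal element for [le] is a minimal seminorm. *)
pose le (p q : T) : bool := `[< forall a, sval q a <= sval p a >].
have [||C Ctot|[p [pP pp0]] pmax] := @ZL_preorder T t0 le.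
- by move=> p; apply/asboolP.
- by move=> p q r /asboolP pq /asboolP qr; apply/asboolP => a; exact: le_trans (pq a).
- have [[c Cc]|C0] := pselect (C !=set0); last first.
    by exists t0 => s Cs; exfalso; apply: C0; exists s.
  pose S a := [set t | exists2 q : T, C q & sval q a <= t].
  have Sb : seminorm_bounds S.
    (* Totality of the chain lets bounds coming from two seminorms be realised by a single one, as
       sums and products require. *)
    have lower q r : C q -> C r ->
        exists2 m : T, C m & forall a, sval m a <= sval q a /\ sval m a <= sval r a.
      move=> Cq Cr; have [/asboolP qr|/asboolP rq] := Ctot _ _ Cq Cr.
        by exists r => // a; split.
      by exists q => // a; split.
    split.
    - by move=> a; exists (sval c a); exists c.
    - by move=> a s [q _]; apply: le_trans; exact: (seminorm_ge0 (svalP q).1).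
    - move=> a b s t [q Cq qs] [r Cr rt]; have [m Cm mqr] := lower q r Cq Cr.
      exists m => //; apply: (le_trans (seminormD (svalP m).1 _ _)).
      by apply: lerD; [apply: le_trans qs|apply: le_trans rt];
        apply mqr.
    - move=> z a s [q Cq qs]; exists q => //.
      apply: (le_trans (seminormZ (svalP q).1 _ _)).
      by rewrite ler_wpM2l// normc_ge0.
    - move=> a b s t [q Cq qs] [r Cr rt]; have [m Cm mqr] := lower q r Cq Cr.
      exists m => //; apply: (le_trans (seminormM (svalP m).1 _ _)).
      by apply: ler_pM; rewrite ?(seminorm_ge0 (svalP m).1)//;
        [apply: le_trans qs|apply: le_trans rt]; apply mqr.
    - by move=> s [q _]; apply: le_trans; exact: (seminorm1 (svalP q).1).
  have Sle a (q : T) : C q -> inf (S a) <= sval q a.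
    by move=> Cq; apply: inf_bounds_le => //; exists q.
  have Sp0 a : inf (S a) <= p0 a.
    by apply: (le_trans (Sle a c Cc)); exact: (svalP c).2.
  exists (exist _ (fun a => inf (S a)) (conj (inf_seminorm Sb) Sp0)).
  by move=> q Cq; apply/asboolP => a /=; exact: Sle.
- exists p => //; split=> // q qP qp a.
  have qp0 b : q b <= p0 b by exact: le_trans (pp0 b).
  have /asboolP := pmax (exist _ q (conj qP qp0)) (introT (asboolP _) qp).
  exact.
Qed.

Lemma minimal_seminorm_le_power p a t : minimal_seminorm p -> 0 <= t ->
  (exists K, forall n, p (a ^+ n) <= K * t ^+ n) -> p a <= t.
Proof.
move=> pmin t0 tK; apply: (minimal_seminorm_le_bounds pmin (power_boundsP pmin.1)).
  move=> b; split; first exact: (seminorm_ge0 pmin.1).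
  by exists (p 1) => n; rewrite mulrC (seminormX pmin.1).
by [].
Qed.

(* If p (a^n) < p(a)^n, some s < p a satisfies p (a^n) <= s^n; splitting exponents
   modulo n then makes s one of the [power_bounds] of a. *)
Lemma minimal_seminormX p a n : minimal_seminorm p -> p a ^+ n <= p (a ^+ n).
Proof.
move=> pmin; have pP := pmin.1; have p0 := seminorm_ge0 pP.
case: n => [|n]; first by rewrite !expr0 (seminorm1 pP).
rewrite leNgt; apply/negP => lt_pX.
have pa0 : 0 < p a.
  rewrite lt_neqAle p0 andbT; apply/eqP => pa0; move: lt_pX.
  by rewrite -pa0 expr0n /= ltNge p0.
pose tau := p (a ^+ n.+1) / p a ^+ n.+1.
have tau1 : tau < 1 by rewrite ltr_pdivrMr ?exprn_gt0// mul1r.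
have tau0 : 0 <= tau by rewrite divr_ge0// exprn_ge0.
(* With this x, Bernoulli gives [(1 - x) ^+ n.+1 >= (1 + tau) / 2 >= tau], hence [sX] for s slightly
   below [p a]. *)
pose x := (1 - tau) / (2 * n.+1%:R).
have nE : n.+1%:R * x = (1 - tau) / 2.
  by rewrite /x; field; rewrite addrC natr1 pnatr_eq0.
have x0 : 0 < x by rewrite divr_gt0 ?subr_gt0// mulr_gt0// ltr0n.
have x1 : x < 1.
  apply: (@le_lt_trans _ _ (n.+1%:R * x)); last by rewrite nE; lra.
  by rewrite ler_peMl ?ler1n ?(ltW x0).
pose s := p a * (1 - x).
have s0 : 0 < s by rewrite mulr_gt0// subr_gt0.
have sX : p (a ^+ n.+1) <= s ^+ n.+1.
  rewrite exprMn mulrC -ler_pdivrMr ?exprn_gt0// -/tau.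
  by apply: le_trans (bernoulli _ (ltW x1)); rewrite nE; lra.
suff : p a <= s by rewrite /s ler_pMr// lerBrDr gerDl leNgt x0.
apply: (minimal_seminorm_le_power pmin (ltW s0)).
(* The remainder r is less than [n.+1] and [p a / s >= 1], so this constant absorbs the loss
   [(p a / s) ^+ r * p 1]. *)
exists ((p a / s) ^+ n.+1 * p 1) => k.
rewrite (divn_eq k n.+1) mulnC; set q := (k %/ _)%N; set r := (k %% _)%N.
rewrite exprD exprM (le_trans (seminormXM pP _ _ _))//.
rewrite exprD exprM [leRHS]mulrCA.
apply: ler_pM; rewrite ?exprn_ge0 ?lerXn2r ?nnegrE ?exprn_ge0 ?(ltW s0)//.
rewrite (le_trans (seminormX pP _ _))// mulrAC ler_wpM2r//.
rewrite -ler_pdivrMr ?exprn_gt0// -expr_div_n ler_weXn2l//.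
  by rewrite ler_pdivlMr// mul1r /s ler_piMr// lerBlDr lerDl ltW.
by rewrite ltnW// ltn_pmod.
Qed.

Lemma minimal_seminormM p a b : minimal_seminorm p -> p (a * b) = p a * p b.
Proof.
move=> pmin; have pP := pmin.1; have p0 := seminorm_ge0 pP.
apply/eqP; rewrite eq_le (seminormM pP)/=.
have [pa0|pa0] := ltrP 0 (p a); last first.
  by have -> : p a = 0; [apply/eqP; rewrite eq_le pa0 p0|rewrite mul0r].
rewrite mulrC -ler_pdivlMr//.
have Sb := orbit_boundsP pP pa0 (fun n => minimal_seminormX a n pmin).
apply: (minimal_seminorm_le_bounds pmin Sb) => [c|].
  by split=> //; exists 0%N; rewrite !expr0 mul1r mulr1.
(* The value [p (a * b) / p a] is an orbit bound of b, with exponent 1. *)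
by split; [rewrite divr_ge0|exists 1%N; rewrite !expr1 divfK// gt_eqF].
Qed.

End submultiplicative_seminorms.

(** * Multiplicative seminorms and characters *)

Section gelfand_mazur.
Variables (R : realType) (A : comAlgType R[i]) (p : A -> R).
Hypothesis pP : submult_seminorm p.
Let p0 := seminorm_ge0 pP.

Lemma seminormB_le a b : `|p a - p b| <= p (a - b).
Proof.
have H c d : p c - p d <= p (c - d).
  by rewrite lerBlDr -{1}(subrK d c) (seminormD pP).
rewrite ler_norml H lerNl opprB andbT.
by rewrite -(seminormN pP (a - b)) opprB H.
Qed.

Lemma seminorm_sub_alg_ge a z : normc z - p a <= p (a - z%:A).
Proof.
rewrite lerBlDr; apply: (le_trans (seminorm_alg_ge pP z)).
rewrite -{1}(opprK z%:A) -{1}(subrK a (- - z%:A)).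
by rewrite opprK -opprB (le_trans (seminormD pP _ _))// (seminormN pP).
Qed.

Lemma normc_le_sum (x y : R) : normc (x +i* y)%C <= `|x| + `|y|.
Proof.
rewrite /normc -(@ler_pXn2r _ 2)// ?nnegrE ?sqrtr_ge0 ?addr_ge0//.
rewrite sqr_sqrtr ?addr_ge0 ?sqr_ge0// sqrrD -!normrX.
rewrite !(ger0_norm (sqr_ge0 _)) lerD2r lerDl.
by rewrite mulrn_wge0// mulr_ge0.
Qed.

Lemma normc_ge_ReIm (z : R[i]) :
  `|complex.Re z| <= normc z /\ `|complex.Im z| <= normc z.
Proof.
case: z => x y /=; split; rewrite -sqrtr_sqr ler_wsqrtr//.
  by rewrite lerDl sqr_ge0.
by rewrite lerDr sqr_ge0.
Qed.

Lemma distance_attained a :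
  exists z0, forall z, p (a - z0%:A) <= p (a - z%:A).
Proof.
pose f (v : R * R) := p (a - (v.1 +i* v.2)%C%:A).
have fcont : continuous f.
  move=> u; apply/cvgrPdist_lt => e e0.
  pose d := e / (2 * p 1).
  have p1 : 0 < p 1 by apply: lt_le_trans (seminorm1 pP).
  have d0 : 0 < d by rewrite divr_gt0// mulr_gt0.
  near=> v.
  apply: (le_lt_trans (seminormB_le _ _)).
  rewrite opprB addrC addrA subrK -scalerBl.
  apply: (le_lt_trans (seminormZ pP _ _)).
  rewrite -ltr_pdivlMr//.
  have -> : ((v.1 +i* v.2) - (u.1 +i* u.2) = (v.1 - u.1) +i* (v.2 - u.2))%C by [].
  apply: (le_lt_trans (normc_le_sum _ _)).
  have -> : e / p 1 = d + d by rewrite /d; field; rewrite gt_eqF.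
  apply: ltrD; rewrite distrC.
    by near: v; move: d d0; apply/cvgrPdist_lt; exact: cvg_fst.
  by near: v; move: d d0; apply/cvgrPdist_lt; exact: cvg_snd.
(* If [normc z > M], then [p (a - z%:A) >= normc z - p a > p a], which is the value at z = 0; a
   minimum over the square of half-side M is therefore global. *)
pose M := 2 * p a + 1.
have M0 : 0 <= M by rewrite addr_ge0// mulr_ge0.
have [|||[x0 y0] _ fmin] := @compact_EVT_min _ R f (`[- M, M] `*` `[- M, M]).
- by exists (0, 0); split; rewrite /= in_itv /= oppr_le0 M0.
- by apply: compact_setX; exact: segment_compact.
- exact: continuous_subspaceT.
exists (x0 +i* y0)%C => z.
have [zM|zM] := boolP ((`|complex.Re z| <= M) && (`|complex.Im z| <= M)).
  case: z zM => x y /= /andP[xM yM]; apply: (fmin (x, y)).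
  by rewrite inE; split; rewrite /= in_itv /= -ler_norml.
have Mz : M < normc z.
  have [H1 H2] := normc_ge_ReIm z.
  by move: zM; rewrite negb_and -!ltNge => /orP[] /lt_le_trans; apply.
have /(_ _)/le_trans := fmin (0, 0); apply.
  by rewrite inE; split; rewrite /= in_itv /= oppr_le0 M0.
rewrite /f /= scale0r subr0 (le_trans _ (seminorm_sub_alg_ge _ _))//.
by rewrite /M in Mz; lra.
Unshelve. all: by end_near. Qed.

Hypothesis pM : forall a b, p (a * b) = p a * p b.

Lemma mult_seminorm1 : p 1 = 1.
Proof.
have p1 : p 1 != 0 by rewrite gt_eqF// (lt_le_trans ltr01)// (seminorm1 pP).
by apply: (mulfI p1); rewrite -pM !mulr1.
Qed.

Lemma mult_seminormX a n : p (a ^+ n) = p a ^+ n.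
Proof.
by elim: n => [|n IH]; rewrite ?expr0 ?mult_seminorm1// !exprS pM IH.
Qed.

(** Over the complex numbers [b ^+ (2 * N) - d] factors as a difference of squares, and the
    induction hypothesis bounds both factors below by [m ^+ N]. *)
Lemma distance_pow2 b m k d : 0 <= m -> (forall z, m <= p (b - z%:A)) ->
  m ^+ (2 ^ k) <= p (b ^+ (2 ^ k) - d%:A).
Proof.
move=> m0 bm; elim: k d => [|k IH] d; first by rewrite expn0 !expr1.
rewrite expnSr !exprM -(sqr_sqrtc d).
have -> : (sqrtc d ^+ 2)%:A = (sqrtc d)%:A ^+ 2 :> A by rewrite exprZn expr1n.
rewrite subr_sqr pM expr2 ler_pM ?exprn_ge0//.
by rewrite -[X in _ + X]opprK -scaleNr.
Qed.

(** In the factorisation of [b ^+ (2 * N) - c ^+ (2 * N)] the minus factor is handled by induction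
    and the plus factor is at least [m ^+ N]. The extra m on the right avoids the exponent
    [N - 1]. *)
Lemma distance_pow2_sub b m k c : 0 <= m -> (forall z, m <= p (b - z%:A)) ->
  p (b - c%:A) * m ^+ (2 ^ k) <= m * p (b ^+ (2 ^ k) - (c ^+ (2 ^ k))%:A).
Proof.
move=> m0 bm; elim: k => [|k IH]; first by rewrite expn0 !expr1 mulrC.
rewrite expnSr !exprM.
have -> : ((c ^+ (2 ^ k)) ^+ 2)%:A = (c ^+ (2 ^ k))%:A ^+ 2 :> A.
  by rewrite exprZn expr1n.
rewrite subr_sqr pM expr2 !mulrA ler_pM ?mulr_ge0 ?exprn_ge0//.
by rewrite -[X in _ + X]opprK -scaleNr distance_pow2.
Qed.

Lemma distance_step b m c : 0 < m -> (forall z, m <= p (b - z%:A)) ->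
  p b = m -> normc c < m -> p (b - c%:A) = m.
Proof.
move=> m0 bm pb cm; apply/eqP; rewrite eq_le bm andbT.
apply/ler_addgt0Pr => e e0.
have rP : 0 <= normc c / m by rewrite divr_ge0 ?normc_ge0 ?ltW.
have r1 : normc c / m < 1 by rewrite ltr_pdivrMr// mul1r.
have : (normc c / m) ^+ n @[n --> \oo] --> (0 : R).
  by apply: cvg_expr; rewrite ger0_norm.
move/cvgrPdist_lt => /(_ (e / m)); rewrite divr_gt0// => /(_ isT)[n _].
move=> /(_ (2 ^ n)%N (ltnW (ltn_expl n (ltnSn 1)))) /=.
rewrite sub0r normrN ger0_norm ?exprn_ge0// => le.
have mn0 : 0 < m ^+ (2 ^ n) by rewrite exprn_gt0.
have := distance_pow2_sub n c (ltW m0) bm.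
rewrite -ler_pdivlMr// => /le_trans; apply.
rewrite ler_pdivrMr//.
apply: (@le_trans _ _ (m * (m ^+ (2 ^ n) + normc c ^+ (2 ^ n)))).
  rewrite ler_wpM2l ?(ltW m0)// (le_trans (seminormD pP _ _))//.
  rewrite (seminormN pP) mult_seminormX pb lerD2l.
  by rewrite (le_trans (seminormZ pP _ _))// mult_seminorm1 mulr1 normcX.
rewrite mulrDr mulrDl lerD2l.
rewrite expr_div_n ltr_pdivrMr// mulrAC ltr_pdivlMr// in le.
by rewrite mulrC ltW.
Qed.

Lemma spectrum_nonempty a : exists z, p (a - z%:A) = 0.
Proof.
have [z0 zmin] := distance_attained a; exists z0.
set m := p (a - z0%:A); apply/eqP; rewrite eq_le p0 andbT leNgt.
apply/negP => m0.
(* Each translate of z0 attains the minimum again, so [distance_step] can be iterated along a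
   ray. *)
have all_m k c : normc c < m -> p (a - (z0 + k%:R * c)%:A) = m.
  move=> cm; elim: k => [|k IH]; first by rewrite mul0r addr0.
  have -> : a - (z0 + k.+1%:R * c)%:A = a - (z0 + k%:R * c)%:A - c%:A.
    by rewrite -natr1 mulrDl mul1r addrA [X in _ - X = _]scalerDl opprD addrA.
  apply: distance_step => // z.
  by rewrite -addrA -opprD -scalerDl zmin.
(* Once [k%:R * (m / 2)] exceeds M, the point [z0 + k%:R * (m / 2)] has modulus above [m + p a], and
   there the distance exceeds m. *)
pose M := m + p a + normc z0 + 1.
have [k kM] : exists k : nat, M < k%:R * (m / 2).
  exists (Num.truncn (M / (m / 2))).+1.
  by rewrite -ltr_pdivrMr ?divr_gt0// truncnS_gt.
have := all_m k ((m / 2)%:C)%C.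
have normcR (x : R) : 0 <= x -> normc (x%:C)%C = x.
  by move=> x0; rewrite /normc /= expr0n addr0 sqrtr_sqr ger0_norm.
have m2 : m / 2 < m by lra.
rewrite normcR ?divr_ge0 ?(ltW m0)// => /(_ m2); apply/eqP; rewrite gt_eqF//.
apply: lt_le_trans (seminorm_sub_alg_ge _ _).
have : k%:R * (m / 2) <= normc (z0 + k%:R * (m / 2)%:C%C) + normc z0.
  have -> : k%:R * (m / 2) = normc (k%:R * (m / 2)%:C%C).
    rewrite -(rmorph_nat (real_complex R)) -rmorphM normcR//.
    by rewrite mulr_ge0// divr_ge0// ltW.
  rewrite -[X in normc X <= _](addKr z0) addrC.
  by rewrite (le_trans (le_normcD _ _))// normcN.
by rewrite /M in kM; lra.
Qed.

Lemma mult_seminorm_character : exists chi : A -> R[i],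
  [/\ scalar chi, {morph chi : a b / a * b}, chi 1 = 1 &
      forall a, normc (chi a) <= p a].
Proof.
have [chi chiP] := choice spectrum_nonempty.
(* Since p dominates the modulus on scalars, [chi a] is the only z with [p (a - z%:A) = 0]; every
   identity for chi reduces to such a vanishing. *)
have chi_uniq a z : p (a - z%:A) = 0 -> chi a = z.
  move=> az; apply/eqP; rewrite -subr_eq0; apply/eqP/eq0_normc/eqP.
  rewrite eq_le normc_ge0 andbT (le_trans (seminorm_alg_ge pP _))//.
  have -> : (chi a - z)%:A = (a - z%:A) - (a - (chi a)%:A) :> A.
    by rewrite scalerBl opprB [RHS]addrC -addrA addKr.
  by rewrite (le_trans (seminormD pP _ _))// (seminormN pP) az chiP addr0.
have small a z : p a <= 0 -> p z = 0 -> p (a + z) = 0.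
  move=> a0 z0; apply/eqP; rewrite eq_le p0 andbT.
  by rewrite (le_trans (seminormD pP _ _))// z0 addr0.
exists chi; split.
- move=> k a b; apply: chi_uniq.
  have -> : k *: a + b - (k * chi a + chi b)%:A =
      k *: (a - (chi a)%:A) + (b - (chi b)%:A).
    by rewrite scalerDl scalerBr scalerA opprD addrACA.
  by apply: small => //; rewrite (le_trans (seminormZ pP _ _))// chiP mulr0.
- move=> a b; apply: chi_uniq.
  have -> : a * b - (chi a * chi b)%:A =
      (a - (chi a)%:A) * b + (chi a)%:A * (b - (chi b)%:A).
    by rewrite mulrBl mulrBr addrA subrK -scalerAl -scalerAr mulr1 scalerA.
  by apply: small; rewrite pM chiP ?mul0r ?mulr0.
- by apply: chi_uniq; rewrite scale1r subrr (seminorm0 pP).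
- move=> a; apply: (le_trans (seminorm_alg_ge pP _)).
  rewrite -(seminormN pP) -[- _](addKr a) -[p a]add0r -(chiP a).
  rewrite [_ + (a - _)]addrC -[p a](seminormN pP).
  exact: (seminormD pP).
Qed.

End gelfand_mazur.

Lemma character_exists (R : realType) (A : comAlgType R[i]) (p : A -> R) :
  submult_seminorm p -> exists chi : A -> R[i],
  [/\ scalar chi, {morph chi : a b / a * b}, chi 1 = 1 &
      forall a, normc (chi a) <= p a].
Proof.
move=> /minimal_seminorm_exists[q qmin qp].
have [chi [chiZ chiM chi1 chiq]] := mult_seminorm_character qmin.1
  (fun a b => minimal_seminormM a b qmin).
by exists chi; split=> // a; exact: le_trans (qp a).
Qed.

(** * The closed graph theorem over the complex numbers *)

Section real_norm.
Variable R : realType.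

Definition rnorm (V : normedModType R[i]) (x : V) : R := complex.Re `|x|.

Section theory.
Variable V : normedModType R[i].
Implicit Types x y : V.

Lemma normE x : `|x| = (rnorm x)%:C%C.
Proof. by rewrite RRe_real// ger0_real. Qed.

Lemma rnorm_ge0 x : 0 <= rnorm x.
Proof. by rewrite -lecR -normE; exact: normr_ge0. Qed.

Lemma rnorm0 : rnorm (0 : V) = 0.
Proof. by rewrite /rnorm normr0. Qed.

Lemma rnorm_eq0 x : rnorm x = 0 -> x = 0.
Proof. by move=> x0; apply/eqP; rewrite -normr_eq0 normE x0. Qed.

Lemma rnormN x : rnorm (- x) = rnorm x.
Proof. by rewrite /rnorm normrN. Qed.

Lemma rnormB x y : rnorm (x - y) = rnorm (y - x).
Proof. by rewrite -rnormN opprB. Qed.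

Lemma rnormD x y : rnorm (x + y) <= rnorm x + rnorm y.
Proof. by rewrite -lecR rmorphD /= -!normE ler_normD. Qed.

Lemma rnorm_triangle z x y : rnorm (x - y) <= rnorm (x - z) + rnorm (z - y).
Proof. by rewrite -{1}(subrK z x) -addrA rnormD. Qed.

Lemma rnormZ (k : R[i]) x : rnorm (k *: x) = normc k * rnorm x.
Proof.
apply: (@complexI R); rewrite rmorphM /= -!normE normrZ.
by congr (_ * _); case: k.
Qed.

Lemma rnormZr (t : R) x : 0 <= t -> rnorm (t%:C%C *: x) = t * rnorm x.
Proof.
by move=> t0; rewrite rnormZ /normc /= expr0n addr0 sqrtr_sqr ger0_norm.
Qed.

Lemma cvg_rnormP (u : nat -> V) x : u @ \oo --> x <->
  forall e : R, 0 < e -> \forall n \near \oo, rnorm (x - u n) < e.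
Proof.
split=> [/cvgrPdist_lt ux e e0|ux].
  have := ux e%:C%C; rewrite ltcR => /(_ e0); apply: filterS => n /=.
  by rewrite normE ltcR.
apply/cvgrPdist_lt => e e0.
have eE : e = (complex.Re e)%:C%C by rewrite RRe_real// gtr0_real.
have := ux (complex.Re e); rewrite -ltcR -eE => /(_ e0).
by apply: filterS => n; rewrite normE {2}eE ltcR.
Qed.

Lemma cvg_norm0P (u : nat -> V) : (`|u n| @[n --> \oo] --> (0 : R[i])) <->
  u @ \oo --> (0 : V).
Proof. by split; [move/norm_cvg0|move/cvg_norm; rewrite normr0]. Qed.

End theory.

Lemma halving_small (c : nat -> R) e : (forall k, c k.+1 <= c k / 2) -> 0 < e ->
  \forall n \near \oo, c n < e.
Proof.
move=> ch e0.
have cn n : c n * 2 ^+ n <= c 0%N.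
  elim: n => [|n IH]; first by rewrite expr0 mulr1.
  by rewrite exprSr (le_trans _ IH)//; have := ch n;
    have : 0 < 2 ^+ n :> R; [rewrite exprn_gt0|nra].
exists (Num.truncn (c 0%N / e)).+1 => // n /= nc.
have ce : c 0%N / e < 2 ^+ n.
  apply: (@lt_le_trans _ _ n%:R); last by rewrite -natrX ler_nat ltnW// ltn_expl.
  by apply: (lt_le_trans (truncnS_gt _)); rewrite ler_nat.
rewrite -(@ltr_pM2r _ (2 ^+ n)) ?exprn_gt0// (le_lt_trans (cn n))//.
by rewrite mulrC -ltr_pdivrMr.
Qed.

Section completeness.
Variables (V : completeNormedModType R[i]) (u : nat -> V) (c : nat -> R).
Hypotheses (uc : forall k, rnorm (u k.+1 - u k) <= c k)
  (ch : forall k, c k.+1 <= c k / 2).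

Lemma halving_cvg : exists2 l, u @ \oo --> l & forall k, rnorm (l - u k) <= 2 * c k.
Proof.
have c0 k : 0 <= c k by exact: le_trans (rnorm_ge0 _) (uc k).
(* The subtracted term makes the induction close: [2 * c (k + m).+1 <= c (k + m)]. *)
have dist k m : rnorm (u (k + m)%N - u k) <= 2 * c k - 2 * c (k + m)%N.
  elim: m => [|m IH]; first by rewrite addn0 !subrr rnorm0.
  rewrite addnS (le_trans (rnorm_triangle (u (k + m)%N) _ _))//.
  by have := uc (k + m); have := ch (k + m); lra.
have dist2 k n : (k <= n)%N -> rnorm (u n - u k) <= 2 * c k.
  move=> kn; rewrite -(subnKC kn) (le_trans (dist _ _))//.
  by rewrite gerBl mulr_ge0.
have /cvg_ex[l ul] : cvg (u @ \oo).
  apply: cauchy_cvg; apply: cauchy_exP => e e0.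
  have eE : e = (complex.Re e)%:C%C by rewrite RRe_real// gtr0_real.
  move: e0; rewrite {}eE; move: (complex.Re e) => {}e; rewrite ltcR => e0.
  have [k _ ck] : \forall n \near \oo, c n < e / 2.
    by apply: halving_small => //; rewrite divr_gt0.
  exists (u k); exists k => // n /= kn.
  rewrite -ball_normE /= normE ltcR rnormB (le_lt_trans (dist2 _ _ kn))//.
  by have := ck k (leqnn k); lra.
exists l => // k; apply/ler_addgt0Pr => e e0.
have /cvg_rnormP/(_ e e0)[n _ ne] := ul.
rewrite (le_trans (rnorm_triangle (u (maxn n k)) _ _))// addrC.
by rewrite lerD ?dist2 ?leq_maxr// ltW// ne//= leq_maxl.
Qed.

End completeness.

(* Baire's theorem, applied to the sublevel sets of [s]. *)
Lemma sublevel_dense_in_ball (V : completeNormedModType R[i]) (s : V -> R) :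
  exists (n : nat) (x0 : V) (r : R), 0 < r /\ forall y, rnorm (y - x0) <= r ->
    forall e, 0 < e -> exists2 z, rnorm (z - y) < e & s z <= n%:R.
Proof.
apply: contrapT => H.
(* If the claim fails, every ball contains a smaller one on which s exceeds n. The latter has radius
   [2 * t'.2] because [halving_cvg] places the limit within twice the step bound. *)
have step (t : nat * (V * R)) : exists t' : V * R, 0 < t.2.2 ->
    [/\ 0 < t'.2, t'.2 <= t.2.2 / 2, rnorm (t'.1 - t.2.1) <= t.2.2 &
     forall z, rnorm (z - t'.1) <= 2 * t'.2 -> t.1%:R < s z].
  case: t => n [x r] /=.
  have [r0|r0] := ltP 0 r; last by exists (x, r).
  apply: contrapT => no; apply: H; exists n, x, r; split=> // y xy e e0.
  apply: contrapT => nz; apply: no.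
  exists (y, Num.min (r / 2) (e / 4)) => _ /=.
  split=> //; first by rewrite lt_min !divr_gt0.
    by rewrite ge_min lexx.
  move=> z zy; rewrite ltNge; apply/negP => sz; apply: nz; exists z => //.
  apply: (le_lt_trans zy); apply: (@le_lt_trans _ _ (2 * (e / 4))).
    by rewrite ler_wpM2l// ge_min lexx orbT.
  lra.
have [f fP] := choice step.
pose v := fix v k := if k is k'.+1 then f (k', v k') else (0, 1).
have v0 k : 0 < (v k).2.
  by elim: k => [|k IH] /=; [exact: ltr01|case: (fP (k, v k) IH)].
have [| |l _ lv] := @halving_cvg V (fun k => (v k).1) (fun k => (v k).2).
- by move=> k; case: (fP (k, v k) (v0 k)).
- by move=> k; case: (fP (k, v k) (v0 k)).
have sl k : k%:R < s l.
  by case: (fP (k, v k) (v0 k)) => _ _ _; apply; exact: (lv k.+1).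
have := sl (Num.truncn (s l)).+1; apply/negP; rewrite -leNgt ltW//.
exact: truncnS_gt.
Qed.

Section closed_graph.
Variables (V W : completeNormedModType R[i]) (T : V -> W).
Hypothesis Tlin : linear T.

Let TB x y : T (x - y) = T x - T y.
Proof. by rewrite addrC -scaleN1r Tlin scaleN1r addrC. Qed.

Let T0 : T 0 = 0. Proof. by rewrite -(subrr 0) TB subrr. Qed.

Let TZ k x : T (k *: x) = k *: T x.
Proof. by rewrite -[k *: x]addr0 Tlin T0 addr0. Qed.

Lemma linear_approx_preimage : exists2 C, 0 <= C & forall y e, 0 < e ->
  exists2 z, rnorm (y - z) < e & rnorm (T z) <= C * rnorm y.
Proof.
have [n [x0 [r [r0 dense]]]] := sublevel_dense_in_ball (fun x => rnorm (T x)).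
exists (2 * n%:R / r); first by rewrite divr_ge0 ?mulr_ge0 ?(ltW r0).
move=> y e e0.
have [y0|yn0] := eqVneq (rnorm y) 0.
  by exists y; rewrite ?subrr ?rnorm0// (rnorm_eq0 y0) T0 !rnorm0 mulr0.
have y0 : 0 < rnorm y by rewrite lt_neqAle eq_sym yn0 rnorm_ge0.
(* This scale puts [x0 + t y] on the boundary of the ball. Approximants of it and of x0 with images
   of norm at most n are subtracted and divided by t, which yields the constant [2 * n%:R / r]; the
   tolerance [t * e / 2] is used twice. *)
pose t := r / rnorm y.
have t0 : 0 < t by rewrite divr_gt0.
have d0 : 0 < t * e / 2 by rewrite divr_gt0// mulr_gt0.
have [|z1 z1y Tz1] := dense (x0 + t%:C%C *: y) _ _ d0.
  by rewrite addrC addKr rnormZr ?(ltW t0)// divfK.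
have [|z2 z2y Tz2] := dense x0 _ _ d0; first by rewrite subrr rnorm0 (ltW r0).
have ti0 : 0 <= t^-1 by rewrite invr_ge0 ltW.
exists ((t^-1)%:C%C *: (z1 - z2)).
  have -> : y - (t^-1)%:C%C *: (z1 - z2) =
      (t^-1)%:C%C *: ((z2 - x0) - (z1 - (x0 + t%:C%C *: y))).
    have -> : z2 - x0 - (z1 - (x0 + t%:C%C *: y)) = t%:C%C *: y - (z1 - z2).
      by rewrite !opprB -(addrA x0) (addrA (z2 - x0)) subrK addrCA.
    by rewrite [RHS]scalerBr scalerA -rmorphM mulVf ?gt_eqF// scale1r.
  rewrite rnormZr// mulrC ltr_pdivrMr//.
  rewrite (le_lt_trans (rnormD _ _))// rnormN.
  by rewrite mulrC (splitr (t * e)) ltrD.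
rewrite TZ TB rnormZr//.
have -> : 2 * n%:R / r * rnorm y = t^-1 * (n%:R + n%:R).
  by rewrite /t; field; rewrite yn0 gt_eqF.
rewrite ler_wpM2l// (le_trans (rnormD _ _))// rnormN lerD//.
Qed.

Hypothesis Tclosed : forall (u : nat -> V) x y,
  u @ \oo --> x -> T \o u @ \oo --> y -> y = T x.

Theorem closed_graph_bounded :
  exists2 C, 0 <= C & forall x, rnorm (T x) <= C * rnorm x.
Proof.
have [C C0 approx] := linear_approx_preimage.
exists (2 * C); first by rewrite mulr_ge0.
move=> x.
have [x0|xn0] := eqVneq (rnorm x) 0.
  by rewrite (rnorm_eq0 x0) T0 !rnorm0 mulr0.
have x0 : 0 < rnorm x by rewrite lt_neqAle eq_sym xn0 rnorm_ge0.
pose d k := rnorm x / 2 ^+ k.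
have dh k : d k.+1 <= d k / 2 by rewrite /d exprSr invfM mulrA.
have d0 k : 0 < d k by rewrite divr_gt0// exprn_gt0.
have step (t : nat * V) : exists z,
    rnorm (t.2 - z) < d t.1.+1 /\ rnorm (T z) <= C * rnorm t.2.
  by have [z] := approx t.2 (d t.1.+1) (d0 _); exists z.
have [f fP] := choice step.
(* [y k] is the remainder after k successive approximations of x, with norm at most [d k]. The
   images of the partial sums [x - y k] move by at most [C * d k], hence converge, and the closed
   graph identifies their limit with [T x]. *)
pose y := fix y k := if k is k'.+1 then y k' - f (k', y k') else x.
have yd k : rnorm (y k) <= d k.
  case: k => [|k]; first by rewrite /d expr0 divr1.
  by have [/ltW] := fP (k, y k).
have ux : (fun k => x - y k) @ \oo --> x.
  apply/cvg_rnormP => e e0; have := halving_small dh e0.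
  apply: filterS => k; rewrite opprB addrC subrK.
  exact: le_lt_trans.
have [||h Tuh hT] := @halving_cvg W (fun k => T (x - y k)) (fun k => C * d k).
- move=> k; have -> : T (x - y k.+1) - T (x - y k) = T (f (k, y k)).
    rewrite -TB /=; congr T.
    by rewrite !opprB addrC addrA subrK addrC subrK.
  by have [_ /le_trans] := fP (k, y k); apply; rewrite ler_wpM2l ?yd.
- by move=> k; rewrite -mulrA ler_wpM2l.
have := hT 0%N; rewrite /= subrr T0 subr0 (Tclosed ux Tuh).
by rewrite /d expr0 divr1 mulrA.
Qed.

End closed_graph.
End real_norm.

(** * Images of strong Ditkin algebras *)

Section surjective_image.
Variables (R : realType) (A1 A2 : completeNormedComAlg R) (T : A1 -> A2).
Hypotheses (Tlin : linear T) (TM : {morph T : a b / a * b})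
  (Tsurj : forall b, exists a, T a = b).

Lemma pullback_scalar (phi : character A2) : scalar (phi \o T).
Proof. by move=> k a b /=; rewrite Tlin (char_scalar phi). Qed.

Lemma pullback_mul (phi : character A2) : {morph phi \o T : a b / a * b}.
Proof. by move=> a b /=; rewrite TM (char_mul phi). Qed.

Lemma pullback_neq0 (phi : character A2) : exists a, (phi \o T) a != 0.
Proof.
by have [b phib] := char_neq0 phi; have [a Ta] := Tsurj b; exists a; rewrite /= Ta.
Qed.

Definition pullback (phi : character A2) : character A1 :=
  Character (pullback_scalar phi) (pullback_mul phi) (pullback_neq0 phi).

(** Evaluating [pullback phi] at a is evaluating phi at [T a], so pointwise convergence is
    preserved. *)
Lemma pullback_continuous : continuous pullback.
Proof.
apply: continuous_comp_initial => phi.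
have phiF : Filter (nbhs phi) by exact: nbhs_filter.
have /(pointwise_cvgP _ (fmap_filter _ phiF)) ev :=
  @initial_continuous _ _ (@char_ptws R A2) phi.
by apply/(pointwise_cvgP _ (fmap_filter _ phiF)) => a; exact: (ev (T a)).
Qed.

(** If phi were in the support of [T a], the preimage of any neighbourhood of [pullback phi] would
    contain some psi with [psi (T a) != 0], placing [pullback phi] in the support of a. *)
Lemma J_pullback phi a : J_ (pullback phi) a -> J_ phi (T a).
Proof.
move=> Ja supp_Ta; apply: Ja => N /pullback_continuous /supp_Ta[psi [psia Npsi]].
by exists (pullback psi).
Qed.

Lemma strong_ditkin_image :
  (forall (u : nat -> A1) x y, u @ \oo --> x -> T \o u @ \oo --> y -> y = T x) ->
  strong_ditkin A1 -> strong_ditkin A2.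
Proof.
move=> Tclosed dit phi.
have [C C0 TC] := closed_graph_bounded Tlin Tclosed.
have [m [u [m0 uJ um uI]]] := dit (pullback phi).
(* Adding 1 keeps the bound positive even when C is 0. *)
exists (C * m + 1), (T \o u); split.
- by rewrite ltr_wpDl// mulr_ge0// ltW.
- by move=> n; exact: J_pullback.
- move=> n; rewrite normE lecR (le_trans (TC _))//.
  have := um n; rewrite normE lecR => unm.
  by rewrite (le_trans (ler_wpM2l C0 unm))// lerDl.
- move=> b; have [a <-] := Tsurj b => phia.
  have /cvg_norm0P/cvg_rnormP au := uI a phia.
  apply/cvg_norm0P/cvg_rnormP => e e0.
  have C1 : 0 < C + 1 by rewrite ltr_wpDl.
  have := au (e / (C + 1)); rewrite divr_gt0// => /(_ isT); apply: filterS => n.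
  rewrite !sub0r !rnormN /=.
  have -> : T a - T a * T (u n) = T (a - a * u n).
    by rewrite -TM addrC -scaleN1r -Tlin scaleN1r addrC.
  rewrite ltr_pdivlMr// => lt_e; rewrite (le_lt_trans (TC _))//.
  rewrite (le_lt_trans _ lt_e)// mulrDr mulr1 mulrC lerDl; exact: rnorm_ge0.
Qed.

End surjective_image.

(** * Continuous characters of Banach algebras, and the maps onto E and B *)

Lemma balg_character_exists (R : realType) (E : comBanachAlg R) :
  exists2 chi : character E, chi 1 = 1 & continuous chi.
Proof.
(* Starting from the norm itself, the character obtained is dominated by the norm, hence
   continuous. *)
have E1 : submult_seminorm (fun a : E => rnorm a).
  have nM (a b : E) : rnorm (a * b) <= rnorm a * rnorm b.
    by rewrite -lecR rmorphM /= -!normE balg_normM.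
  split=> //.
  - by move=> a; exact: rnorm_ge0.
  - by move=> a b; exact: rnormD.
  - by move=> z a; rewrite rnormZ.
  - have := nM 1 1; rewrite [1 * 1]mulr1 ler_pMr//.
    rewrite lt_neqAle rnorm_ge0 andbT eq_sym.
    by apply: contra (oner_neq0 E) => /eqP/rnorm_eq0 ->.
have [chi [chiZ chiM chi1 chiN]] := character_exists E1.
have chi0 : exists a, chi a != 0 by exists 1; rewrite chi1 oner_neq0.
exists (Character chiZ chiM chi0) => //= x.
apply/cvgrPdist_lt => e e0; near=> y.
have -> : chi x - chi y = chi (x - y).
  by rewrite [x - y]addrC -(scaleN1r y) chiZ mulN1r addrC.
have -> : `|chi (x - y)| = (normc (chi (x - y)))%:C%C by case: (chi _).
have : (normc (chi (x - y)))%:C%C <= `|x - y| by rewrite normE lecR.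
move=> /le_lt_trans; apply.
by near: y; move: e e0; apply/cvgrPdist_lt; exact: cvg_id.
Unshelve. all: by end_near. Qed.

Lemma characterZ (R : realType) (A : completeNormedComAlg R) (phi : character A)
  k a : phi (k *: a) = k * phi a.
Proof.
by rewrite -{1}(subrK 1 k) scalerDl scale1r (char_scalar phi) mulrBl mul1r subrK.
Qed.

Theorem corollary3p3 (R : realType) (X : topologicalType) (E : comBanachAlg R)
    (B : functionAlgebra X (complex_balg R)) (Bt : functionAlgebra X E)
    (adm : admissible B Bt) (dit : strong_ditkin Bt) :
  strong_ditkin E /\ strong_ditkin B.
Proof.
split.
(* On an empty X all functions coincide, which would force 1 = 0 in [Bt]. *)
- have [x _] : exists x : X, True.
    apply: contrapT => noX; have /eqP := oner_neq0 Bt; apply.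
    by apply: (@feval_inj _ _ _ Bt); apply/funext => x; case: noX; exists x.
  apply: (@strong_ditkin_image R Bt E (fun f => feval f x)) => //.
  + by move=> k f g; exact: feval_linear.
  + by move=> f g; exact: fevalM.
  + move=> a; have [f fE] := adm_tensor adm 1 a.
    by exists f; rewrite fE feval1 scale1r.
  + move=> u f y uf /norm_cvg_unique; apply.
    by apply: (cvg_comp _ _ uf); exact: feval_at_continuous.
have [chi chi1 chi_cont] := balg_character_exists E.
have [T TE] := choice (fun f => adm_comp adm f chi).
have Tx f x : feval (T f) x = chi (feval f x) by rewrite TE.
apply: (@strong_ditkin_image R Bt B T) => //.
- move=> k f g; apply: feval_inj; apply/funext => x.
  by rewrite feval_linear !Tx feval_linear (char_scalar chi).
- move=> f g; apply: feval_inj; apply/funext => x.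
  by rewrite fevalM !Tx fevalM (char_mul chi).
(* As [chi 1 = 1], the function [g] times the unit of E is a preimage of g. *)
- move=> g; have [f fE] := adm_tensor adm g 1.
  exists f; apply: feval_inj; apply/funext => x; rewrite Tx fE.
  by rewrite characterZ chi1 mulr1.
(* The graph is closed because limits can be compared pointwise: evaluations on B and [Bt] and the
   character chi are continuous. *)
- move=> u f g uf Tug; apply: feval_inj; apply/funext => x.
  have Tux : (@feval _ _ _ B)^~ x \o (T \o u) @ \oo --> feval g x.
    by apply: (cvg_comp _ _ Tug); exact: feval_at_continuous.
  apply: (norm_cvg_unique Tux); rewrite Tx.
  rewrite (_ : _ \o _ = chi \o ((@feval _ _ _ Bt)^~ x \o u)); last first.
    by apply/funext => n; rewrite /= Tx.
  apply: cvg_comp; last exact: chi_cont.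
  by apply: (cvg_comp _ _ uf); exact: feval_at_continuous.
Qed.
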